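(* Let $N\ge 3$, let $\Omega\subset\mathbb{R}^N$ be a domain containing $0$, let $p\ge 0$ and $0\le q\le 2$, and assume $$(N-2)p+(N-1)q<N.$$ If $u\in C^2(\Omega\setminus\{0\})$ is a positive solution of $$-\Delta u=u^p|\nabla u|^q\quad\text{in }\Omega\setminus\{0\},$$ then there exist $R>0$ and a constant $c>0$ (which may depend on $u$) such that $$u(x)+|x|\,|\nabla u(x)|\le c\,|x|^{2-N}\qquad\text{for all } x \text{ with } 0<|x|\le \tfrac{R}{2}.$$
   Context: A domain is a connected open set. $|\cdot|$ denotes the Euclidean norm. *)

(* Defs.v *)
From mathcomp Require Import all_boot all_order all_algebra.
From mathcomp Require Import all_classical all_reals all_analysis.

Set Implicit Arguments.
Unset Strict Implicit.
Unset Printing Implicit Defensive.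
Import Order.TTheory GRing.Theory Num.Theory.
Import numFieldNormedType.Exports.

Local Open Scope classical_set_scope.
Local Open Scope ring_scope.

(* The canonical norm [`|x|] on ['rV[R]_n] is the sup norm; it induces the
   usual topology but is not the Euclidean norm. *)
Definition enorm (R : realType) (n : nat) (x : 'rV[R]_n) : R :=
  Num.sqrt (\sum_(i < n) x ord0 i ^+ 2).

Definition partial (R : realType) (n : nat) (i : 'I_n) (f : 'rV[R]_n -> R) :
  'rV[R]_n -> R := fun x => 'D_(delta_mx ord0 i) f x.

Definition grad (R : realType) (n : nat) (f : 'rV[R]_n -> R) (x : 'rV[R]_n) :
  'rV[R]_n := \row_(i < n) partial i f x.

Definition laplacian (R : realType) (n : nat) (f : 'rV[R]_n -> R)
  (x : 'rV[R]_n) : R := \sum_(i < n) partial i (partial i f) x.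

(* [f] is of class C^k on [U]: its (possibly mixed) partial derivatives up to
   order [k] exist and are continuous at each point of [U].  This is meant for
   [U] open, in which case it depends only on the restriction of [f] to [U]. *)
Fixpoint Ck_on (R : realType) (n : nat) (k : nat) (U : set 'rV[R]_n)
    (f : 'rV[R]_n -> R) : Prop :=
  (forall x, U x -> {for x, continuous f}) /\
  if k is k'.+1 then
    forall i : 'I_n,
      (forall x, U x -> derivable f x (delta_mx ord0 i)) /\
      Ck_on k' U (partial i f)
  else True.

Definition domain (R : realType) (n : nat) (U : set 'rV[R]_n) : Prop :=
  open U /\ connected U.

(* Main.v *)
Require Import Defs.
From mathcomp Require Import all_boot all_order all_algebra.
From mathcomp Require Import all_classical all_reals all_analysis.
From mathcomp Require Import ring lra.


Set Implicit Arguments.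
Unset Strict Implicit.
Unset Printing Implicit Defensive.
Import Order.TTheory GRing.Theory Num.Theory.
Import numFieldNormedType.Exports.

Local Open Scope classical_set_scope.
Local Open Scope ring_scope.

(* No integration is needed: everything follows from the minimum principle.
   Write m = N - 2.

   (1) [u] is a positive supersolution in a punctured ball, so if u >= mu on a
   small sphere of radius rho about y, comparison with a multiple of the
   fundamental solution with pole y gives mu rho^m <= C u(z0) at a fixed point
   z0 away from the origin, with C independent of y.

   (2) If |u| <= S and |Delta u| <= K on a ball of radius rho about y, then
   |grad u(y)| <= C (S / rho + K rho).

   (3) Fix x near 0, let d be the distance to the boundary of the ball of radius
   |x| / 2 about x, and let l be the least number for which d^m u <= (L l)^m and
   d^(m+1) |grad u| <= l^(m+1) on that ball, with L a large constant.  Equality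
   holds at some y; put lambda = l / d(y), so that u <= (2 L lambda)^m and
   |grad u| <= (2 lambda)^(m+1) on the ball of radius d(y) / 2 about y.  If
   u(y) = (L lambda)^m, the gradient bound gives u >= u(y) / 2 on the ball of
   radius 1 / lambda, and (1) yields L^m <= 2 C, which L was chosen to violate.
   If |grad u(y)| = lambda^(m+1), then (2) at radius s / lambda gives
   lambda^(m+1) <= lambda^(m+1) / 4 + C lambda^(m p + (m+1) q - 1), which bounds
   lambda because m p + (m+1) q < m + 2.  In either case l is bounded
   independently of x, and evaluating at x gives the estimate. *)

(** * Second derivatives of functions of one variable and of slices *)

(* Used on the slices [t |-> w (z + t e_i)], so that Laplacians are sums of such
   second derivatives. *)
Definition diff2_at0 (R : realType) (g : R -> R) (a : R) : Prop :=
  exists2 g' : R -> R,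
    \forall t \near (0 : R), is_derive t (1 : R) g (g' t)
    & is_derive (0 : R) (1 : R) g' a.

Lemma is_derive_lt0_right (R : realType) (g : R -> R) (d : R) :
  is_derive (0 : R) (1 : R) g d -> d < 0 ->
  exists2 e, 0 < e & forall t, 0 < t -> t < e -> g t < g 0.
Proof.
move=> [dv va] d0.
have : (fun h : R => h^-1 *: (g (h *: 1 + 0) - g 0)) @ 0^' --> d.
  by rewrite -va; exact: dv.
move=> /(@cvgr_lt _ _) - /(_ 0 d0) /nbhs_norm0P[e /= e0 He].
exists e => // t t0 te; have /= := He t; rewrite gtr0_norm //.
move=> /(_ te); rewrite gt_eqF // => /(_ isT).
rewrite addr0 [t *: 1]mulr1 /GRing.scale /= pmulr_rlt0 ?invr_gt0 //.
by rewrite subr_lt0.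
Qed.

(** The first derivative vanishes at the minimum; if [a] were negative, it would be negative just to
    the right of [0], and the mean value theorem would give a value below [g 0]. *)
Lemma diff2_at0_min (R : realType) (g : R -> R) (a : R) :
  diff2_at0 g a -> (\forall t \near (0 : R), g 0 <= g t) -> 0 <= a.
Proof.
case=> g' dg dg' gmin.
have /nbhs_norm0P[e /= e0 He] :
    \forall t \near (0 : R), is_derive t (1 : R) g (g' t) /\ g 0 <= g t.
  exact: filterI dg gmin.
have in_e t : `|t| < e -> is_derive t (1 : R) g (g' t) /\ g 0 <= g t.
  exact: He.
have e20 : 0 < e / 2 by lra.
have itv_e t : t \in `](- (e / 2)), (e / 2)[ -> `|t| < e.
  by rewrite in_itv /= ltr_norml => /andP[? ?]; apply/andP; split; lra.
have g'0 : g' 0 = 0.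
  have d0 := (in_e 0 _).1; rewrite normr0 in d0; have {}d0 := d0 e0.
  have dg0 : is_derive (0 : R) (1 : R) g 0.
    apply: (@derive1_at_min _ g (- (e / 2)) (e / 2)).
    - lra.
    - by move=> t /itv_e /in_e[[]].
    - by rewrite in_itv /=; apply/andP; split; lra.
    - by move=> t /itv_e /in_e[].
  by rewrite -(@derive_val _ _ _ _ _ _ _ d0) (@derive_val _ _ _ _ _ _ _ dg0).
rewrite leNgt; apply/negP => a0.
have [d d0 g'neg] := is_derive_lt0_right dg' a0.
pose h := Num.min (d / 2) (e / 2).
have h0 : 0 < h by rewrite lt_min; apply/andP; split; lra.
have hd : h < d by rewrite gt_min; apply/orP; left; lra.
have he : h < e by rewrite gt_min; apply/orP; right; lra.
have [||c /[!in_itv]/= /andP[c0 ch]] := @MVT _ g g' 0 h h0.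
- move=> t /[!in_itv]/= /andP[t0 th]; apply: (in_e t _).1.
  by rewrite gtr0_norm //; lra.
- apply: derivable_within_continuous => t /[!in_itv]/= /andP[t0 th].
  by have [] := (in_e t _).1 => //; rewrite ger0_norm //; lra.
- move=> E; have := (in_e h _).2; rewrite gtr0_norm // => /(_ he).
  have : g' c * (h - 0) < 0.
    by rewrite subr0 nmulr_rlt0 // -g'0; apply: g'neg => //; lra.
  lra.
Qed.

Lemma diff2_at0D (R : realType) (f g : R -> R) (a b : R) :
  diff2_at0 f a -> diff2_at0 g b -> diff2_at0 (fun t => f t + g t) (a + b).
Proof.
move=> [f' df df'] [g' dg dg']; exists (fun t => f' t + g' t).
  by near=> t; apply: is_deriveD; near: t.
exact: is_deriveD.
Unshelve. all: by end_near. Qed.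

Lemma diff2_at0Z (R : realType) (k : R) (f : R -> R) (a : R) :
  diff2_at0 f a -> diff2_at0 (fun t => k * f t) (k * a).
Proof.
move=> [f' df df']; exists (fun t => k * f' t).
  by near=> t; apply: (@is_deriveZ R R^o R^o); near: t.
exact: (@is_deriveZ R R^o R^o).
Unshelve. all: by end_near. Qed.

Lemma diff2_at0_opp (R : realType) (f : R -> R) (a : R) :
  diff2_at0 f a -> diff2_at0 (fun t => f (- t)) a.
Proof.
move=> [f' df df']; exists (fun t => - f' (- t)).
  have : \forall t \near (0 : R), is_derive (- t) (1 : R) f (f' (- t)).
    have /nbhs_norm0P[e /= e0 He] := df.
    by apply/nbhs_norm0P; exists e => //= t te; apply: He; rewrite /= normrN.
  apply: filterS => t dt; rewrite -mulrN1.
  exact: (@is_derive1_comp R f (fun t => - t) t).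
have : is_derive (0 : R) (1 : R) (fun t => f' (- t)) (a * - 1).
  by apply: (@is_derive1_comp R f' (fun t => - t) 0); rewrite oppr0.
by move=> /(@is_deriveN R R^o R^o); rewrite mulrN1 opprK.
Qed.

Lemma is_derive_slice (R : realType) n (f : 'rV[R]_n -> R) (z v : 'rV[R]_n) t :
  derivable f (z + t *: v) v ->
  is_derive t (1 : R) (fun s => f (z + s *: v)) ('D_v f (z + t *: v)).
Proof.
have E : (fun h => h^-1 *: (f (h *: v + (z + t *: v)) - f (z + t *: v))) =
    (fun h : R => h^-1 *: (f (z + (h *: (1 : R) + t) *: v) - f (z + t *: v))).
  apply/funext => h; congr (_ *: (f _ - _)).
  by rewrite [h *: (1 : R)]mulr1 scalerDl addrCA.
move=> d; split; last by rewrite /derive E.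
by move: d; rewrite /derivable E.
Qed.

Lemma diff2_at0_slice (R : realType) n (f : 'rV[R]_n -> R) (z v : 'rV[R]_n) :
  (\forall t \near (0 : R), derivable f (z + t *: v) v) ->
  derivable ('D_v f) z v ->
  diff2_at0 (fun t => f (z + t *: v)) ('D_v ('D_v f) z).
Proof.
move=> df ddf; exists (fun t => 'D_v f (z + t *: v)).
  by apply: filterS df => t; exact: is_derive_slice.
have z0 : z + (0 : R) *: v = z by rewrite scale0r addr0.
have D := @is_derive_slice R n ('D_v f) z v 0.
rewrite z0 in D.
exact: (D ddf).
Qed.

Lemma diff2_at0_quad (R : realType) (a b c : R) :
  diff2_at0 (fun t => a + b * t + c * t ^+ 2) (2 * c).
Proof.
exists (fun t => b + 2 * c * t).
  near=> t; apply: is_derive_eq; rewrite /GRing.scale/=; ring.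
apply: is_derive_eq; rewrite /GRing.scale/=; ring.
Unshelve. all: by end_near. Qed.

(** With [c] the square of |x| and [b] the coordinate x_i, the quadratic polynomial is |x + t
    e_i|^2, so this is the second derivative of |x|^(2a) along e_i. *)
Lemma diff2_at0_powR (R : realType) (a b c : R) : 0 < c ->
  diff2_at0 (fun t => (c + 2 * b * t + t ^+ 2) `^ a)
    (2 * a * c `^ (a - 1) + 4 * (a * (a - 1)) * b ^+ 2 * c `^ (a - 2)).
Proof.
move=> c0; pose s t : R := c + 2 * b * t + t ^+ 2.
have ds t : is_derive t (1 : R) s (2 * b + 2 * t).
  by apply: is_derive_eq; rewrite /GRing.scale/=; ring.
have s0 : s 0 = c by rewrite /s; ring.
have dp k t : 0 < s t -> is_derive t (1 : R) (fun t => s t `^ k)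
    (k * s t `^ (k - 1) * (2 * b + 2 * t)).
  move=> st; exact: (@is_derive1_comp R (powR (R:=R) ^~ k) s t _ _
    (is_derive1_powR k st) (ds t)).
exists (fun t => a * s t `^ (a - 1) * (2 * b + 2 * t)).
  have : \forall t \near (0 : R), 0 < s t.
    have : {for 0, continuous s}.
      by apply: differentiable_continuous; apply/derivable1_diffP; have [] := ds 0.
    by move=> /cvgr_gt; apply; rewrite s0.
  by apply: filterS => t; exact: dp.
have ds0 : 0 < s 0 by rewrite s0.
have := dp (a - 1) 0 ds0 => dd.
apply: is_derive_eq; rewrite /GRing.scale/= s0.
have -> : a - 1 - 1 = a - 2 by ring.
ring.
Qed.

(** * The minimum principle *)

(** At a minimum point over the compact [K] the second derivatives along the axes are nonnegative,
    which excludes the second alternative. Boundary points of [K] are those handled by the first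
    alternative. *)
Lemma minimum_principle (R : realType) n (K : set 'rV[R]_n)
    (w : 'rV[R]_n -> R) :
  closed K -> bounded_set K -> (forall z, K z -> {for z, continuous w}) ->
  (forall z, K z -> 0 <= w z \/ exists a : 'I_n -> R,
    [/\ forall i, \forall t \near (0 : R), K (z + t *: delta_mx ord0 i),
        forall i, diff2_at0 (fun t => w (z + t *: delta_mx ord0 i)) (a i) &
        \sum_i a i < 0]) ->
  forall z, K z -> 0 <= w z.
Proof.
move=> clK bK cw wK z Kz.
have cK := bounded_closed_compact bK clK.
have cwK : {within K, continuous w}.
  by apply: continuous_in_subspaceT => x /set_mem; exact: cw.
have [|c /set_mem Kc cmin] := EVT_min_rV _ cK cwK; first by exists z.
apply: le_trans (cmin z (mem_set Kz)).
have [//|[a [Kt dw a0]]] := wK c Kc.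
suff : 0 <= \sum_i a i by lra.
apply: sumr_ge0 => i _; apply: diff2_at0_min (dw i) _.
apply: filterS (Kt i) => t Ktt; rewrite scale0r addr0.
exact: cmin (mem_set Ktt).
Qed.

(** * The Euclidean norm *)

Lemma enorm_ge0 (R : realType) n (x : 'rV[R]_n) : 0 <= enorm x.
Proof. exact: sqrtr_ge0. Qed.

Lemma sqr_enorm (R : realType) n (x : 'rV[R]_n) :
  enorm x ^+ 2 = \sum_(i < n) x ord0 i ^+ 2.
Proof. by rewrite sqr_sqrtr // sumr_ge0 // => i _; exact: sqr_ge0. Qed.

Lemma enorm0 (R : realType) n : enorm (0 : 'rV[R]_n) = 0.
Proof.
by rewrite /enorm big1 ?sqrtr0 // => i _; rewrite mxE expr0n.
Qed.

Lemma normr_coord_enorm (R : realType) n (x : 'rV[R]_n) i :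
  `|x ord0 i| <= enorm x.
Proof.
rewrite -sqrtr_sqr /enorm ler_sqrt; last first.
  by apply: sumr_ge0 => j _; exact: sqr_ge0.
rewrite (bigD1 i) //= lerDl; apply: sumr_ge0 => j _; exact: sqr_ge0.
Qed.

Lemma enorm_gt0 (R : realType) n (x : 'rV[R]_n) : (0 < enorm x) = (x != 0).
Proof.
apply/idP/idP; first by apply: contraTneq => ->; rewrite enorm0 ltxx.
apply: contraNT; rewrite -leNgt => x0; apply/eqP/rowP => i; rewrite mxE.
by apply/eqP; rewrite -normr_le0; apply: le_trans x0; exact: normr_coord_enorm.
Qed.

Lemma enormN (R : realType) n (x : 'rV[R]_n) : enorm (- x) = enorm x.
Proof. by rewrite /enorm; under eq_bigr do rewrite mxE sqrrN. Qed.

Lemma enorm_sub (R : realType) n (x y : 'rV[R]_n) : enorm (x - y) = enorm (y - x).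
Proof. by rewrite -opprB enormN. Qed.

(** Cauchy-Schwarz, from the nonnegativity of the squared norm of |y| x - |x| y. *)
Lemma dot_le_enorm (R : realType) n (x y : 'rV[R]_n) :
  \sum_i x ord0 i * y ord0 i <= enorm x * enorm y.
Proof.
have [x0|x0] := eqVneq x 0.
  by rewrite x0 enorm0 mul0r big1 // => i _; rewrite mxE mul0r.
have [y0|y0] := eqVneq y 0.
  by rewrite y0 enorm0 mulr0 big1 // => i _; rewrite mxE mulr0.
rewrite -enorm_gt0 in x0; rewrite -enorm_gt0 in y0.
have : 0 <= \sum_i (enorm y * x ord0 i - enorm x * y ord0 i) ^+ 2.
  by apply: sumr_ge0 => i _; exact: sqr_ge0.
have -> : \sum_i (enorm y * x ord0 i - enorm x * y ord0 i) ^+ 2 =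
    2 * (enorm x * enorm y) * (enorm x * enorm y - \sum_i x ord0 i * y ord0 i).
  transitivity (\sum_i (enorm y ^+ 2 * x ord0 i ^+ 2 +
      enorm x ^+ 2 * y ord0 i ^+ 2 -
      2 * (enorm x * enorm y) * (x ord0 i * y ord0 i))).
    by apply: eq_bigr => i _; ring.
  rewrite sumrB big_split /= -!mulr_sumr -!sqr_enorm; ring.
rewrite pmulr_rge0 ?subr_ge0 //.
by rewrite mulr_gt0 // mulr_gt0.
Qed.

Lemma enormD (R : realType) n (x y : 'rV[R]_n) :
  enorm (x + y) <= enorm x + enorm y.
Proof.
rewrite -ler_sqr ?nnegrE ?addr_ge0 ?enorm_ge0 // sqr_enorm.
have -> : \sum_i (x + y) ord0 i ^+ 2 =
    enorm x ^+ 2 + enorm y ^+ 2 + 2 * \sum_i x ord0 i * y ord0 i.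
  rewrite !sqr_enorm mulr_sumr -!big_split /=.
  by apply: eq_bigr => i _; rewrite mxE; ring.
have := dot_le_enorm x y; nra.
Qed.

Lemma enormB_le (R : realType) n (x y z : 'rV[R]_n) :
  enorm (x - z) <= enorm (x - y) + enorm (y - z).
Proof. by rewrite -[x - z](subrKA y); exact: enormD. Qed.

Lemma sqr_enormD_delta (R : realType) n (x : 'rV[R]_n) t i :
  enorm (x + t *: delta_mx ord0 i) ^+ 2 =
  enorm x ^+ 2 + 2 * x ord0 i * t + t ^+ 2.
Proof.
rewrite !sqr_enorm (bigD1 i) //= [in RHS](bigD1 i) //=.
under eq_bigr => j ji.
  rewrite !mxE (negbTE ji) andbF mulr0 addr0; over.
rewrite !mxE !eqxx mulr1; ring.
Qed.

Lemma enorm_le_sum (R : realType) n (x : 'rV[R]_n) :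
  enorm x <= \sum_i `|x ord0 i|.
Proof.
have s0 : 0 <= \sum_i `|x ord0 i| by apply: sumr_ge0.
rewrite -ler_sqr ?nnegrE ?enorm_ge0 // sqr_enorm expr2 mulr_suml.
apply: ler_sum => i _; rewrite -real_normK ?num_real // expr2 ler_wpM2l //.
by rewrite (bigD1 i) //= lerDl; apply: sumr_ge0.
Qed.

Lemma normr_le_enorm (R : realType) n (x : 'rV[R]_n) : `|x| <= enorm x.
Proof.
rewrite /Num.norm /= mx_normrE; apply/bigmax_leP; split; first exact: enorm_ge0.
by move=> [i j] _ /=; rewrite (ord1 i); exact: normr_coord_enorm.
Qed.

(** * Continuity, closedness and boundedness *)

Lemma continuous_enorm (R : realType) n : continuous (@enorm R n).
Proof.
move=> x; apply: (@continuous_comp _ _ _ _ (@Num.sqrt R)); last first.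
  exact: sqrt_continuous.
move: x; apply: continuous_big => [|i _ x]; first exact: add_continuous.
apply: (@continuous_comp _ _ _ (fun x : 'rV[R]_n => x ord0 i) (fun y => y ^+ 2)).
  exact: coord_continuous.
exact: exprn_continuous.
Qed.

Lemma continuous_enormB (R : realType) n (y : 'rV[R]_n) :
  continuous (fun x : 'rV[R]_n => enorm (x - y)).
Proof.
move=> x.
apply: (@continuous_comp _ _ _ (fun x : 'rV[R]_n => x - y)).
  by apply: continuousB; [exact: cvg_id|exact: cst_continuous].
exact: continuous_enorm.
Qed.

Lemma continuous_coordB (R : realType) n (y : 'rV[R]_n) i :
  continuous (fun x : 'rV[R]_n => (x - y) ord0 i).
Proof.
move=> x; apply: (@continuous_comp _ _ _ (fun x : 'rV[R]_n => x - y)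
  (fun x : 'rV[R]_n => x ord0 i)); last exact: coord_continuous.
by apply: continuousB; [exact: cvg_id|exact: cst_continuous].
Qed.

Lemma continuous_line (R : realType) n (z v : 'rV[R]_n) :
  continuous (fun t : R => z + t *: v).
Proof.
move=> t; apply: (@cvgD R 'rV[R]_n _ _ _ (cst z)); first exact: cvg_cst.
exact: (@cvgZr_tmp R 'rV[R]_n _ _ _ id t v cvg_id).
Qed.

Lemma closed_ge_continuous (R : realType) (T : topologicalType) (f : T -> R) a :
  continuous f -> closed [set z | a <= f z].
Proof.
by move=> cf; apply: (preimage_closed _ (@closed_ge _ a)) => x _; exact: cf.
Qed.

Lemma closed_le_continuous (R : realType) (T : topologicalType) (f : T -> R) a :
  continuous f -> closed [set z | f z <= a].
Proof.
by move=> cf; apply: (preimage_closed _ (@closed_le _ a)) => x _; exact: cf.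
Qed.

Lemma bounded_enorm_ball (R : realType) n (y : 'rV[R]_n) (r : R)
    (K : set 'rV[R]_n) :
  (forall z, K z -> enorm (z - y) <= r) -> bounded_set K.
Proof.
move=> Kr; exists (r + enorm y); split; first exact: num_real.
move=> M /ltW rM x /Kr xr; apply: le_trans rM.
apply: le_trans (normr_le_enorm x) _.
rewrite -[x in enorm x](subrK y); apply: le_trans (enormD _ _) _.
by rewrite lerD2r.
Qed.

Lemma near_line (R : realType) n (f : 'rV[R]_n -> R) (z v : 'rV[R]_n) a :
  {for z, continuous f} -> a < f z ->
  \forall t \near (0 : R), a < f (z + t *: v).
Proof.
move=> cf az; have : {for (0 : R), continuous (fun t : R => f (z + t *: v))}.
  apply: continuous_comp; first exact: continuous_line.
  by rewrite scale0r addr0.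
by move=> /cvgr_gt; apply; rewrite scale0r addr0.
Qed.

(** This is the shape of both comparison functions to which the minimum principle is applied
    below. *)
Lemma continuous_affine3 (R : realType) (T : topologicalType) (f g h : T -> R)
    (a b c : R) (z : T) :
  {for z, continuous f} -> {for z, continuous g} -> {for z, continuous h} ->
  {for z, continuous (fun x => f x + a * g x + b + c * h x)}.
Proof.
move=> cf cg ch; apply: (@cvgD R R); last exact: cvgMl_tmp.
apply: (@cvgD R R); last exact: cvg_cst.
by apply: (@cvgD R R) => //; exact: cvgMl_tmp.
Qed.

(** * Powers of the distance and comparison with the fundamental solution *)

Lemma continuous_powR_enormB (R : realType) n (y z : 'rV[R]_n) (a : R) :
  0 < enorm (z - y) ->
  {for z, continuous (fun x : 'rV[R]_n => enorm (x - y) `^ a)}.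
Proof.
move=> zy; apply: (@continuous_comp _ _ _ _ (powR (R:=R) ^~ a)).
  exact: continuous_enormB.
apply: differentiable_continuous; apply/derivable1_diffP.
by have [] := is_derive1_powR a zy.
Qed.

(** Used with [a] = 2 - n, where the sum vanishes and the power is harmonic off its pole, and with
    [a] = -1/2, where for n >= 3 the sum is negative and the power strictly superharmonic. *)
Lemma diff2_slices_powR (R : realType) n (y z : 'rV[R]_n) (a : R) :
  0 < enorm (z - y) ->
  exists2 b : 'I_n -> R,
    forall i, diff2_at0
      (fun t => enorm (z + t *: delta_mx ord0 i - y) `^ a) (b i)
    & \sum_i b i = a * (n%:R + a - 2) * enorm (z - y) `^ (a - 2).
Proof.
move=> zy; set c := enorm (z - y) ^+ 2.
have c0 : 0 < c by rewrite exprn_gt0.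
have cE (w : 'rV[R]_n) s : (enorm w ^+ 2) `^ (s / 2) = enorm w `^ s.
  rewrite -powR_mulrn ?enorm_ge0 // -powRrM; congr (_ `^ _); first by field.
exists (fun i => 2 * (a / 2) * c `^ (a / 2 - 1) +
    4 * (a / 2 * (a / 2 - 1)) * ((z - y) ord0 i) ^+ 2 * c `^ (a / 2 - 2)).
  move=> i; have := diff2_at0_powR (a / 2) ((z - y) ord0 i) c0.
  congr (diff2_at0 _ _); apply/funext => t.
  by rewrite -sqr_enormD_delta cE; congr (enorm _ `^ _); rewrite addrAC.
rewrite big_split /= sumr_const card_ord -mulr_suml -mulr_sumr -sqr_enorm -/c.
have -> : c `^ (a / 2 - 1) = enorm (z - y) `^ (a - 2).
  by rewrite -cE; congr (_ `^ _); field.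
have -> : 4 * (a / 2 * (a / 2 - 1)) * c * c `^ (a / 2 - 2) =
    a * (a - 2) * (c * c `^ (a / 2 - 2)) by field.
have -> : c * c `^ (a / 2 - 2) = enorm (z - y) `^ (a - 2).
  rewrite -{1}(powRr1 (ltW c0)) -powRD; last by rewrite (gt_eqF c0) implybT.
  by rewrite -cE; congr (_ `^ _); field.
by rewrite -mulr_natr; field.
Qed.

(* Comparison with the multiple of the fundamental solution with pole [y]
   which vanishes at distance [7 r / 8] from [y]; the strictly superharmonic
   term [eps |x|^(-1/2)] takes care of the singularity at the origin. *)
Lemma superharmonic_ge_fundamental (R : realType) k (r rho mu : R)
    (u : 'rV[R]_k.+3 -> R) (y z0 : 'rV[R]_k.+3) :
  0 < r ->
  (forall z, 0 < enorm z -> enorm z <= r -> {for z, continuous u}) ->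
  (forall z, 0 < enorm z -> enorm z <= r -> 0 <= u z) ->
  (forall z, 0 < enorm z -> enorm z < r -> exists2 a : 'I_k.+3 -> R,
     forall i, diff2_at0 (fun t => u (z + t *: delta_mx ord0 i)) (a i) &
     \sum_i a i <= 0) ->
  enorm y <= r / 8 -> 0 < rho -> rho <= r / 4 -> 0 <= mu ->
  (forall z, z != 0 -> enorm (z - y) = rho -> mu <= u z) ->
  enorm z0 = r / 2 ->
  mu * rho ^+ k.+1 * (((5 * r / 8) ^+ k.+1)^-1 - ((7 * r / 8) ^+ k.+1)^-1) <=
    u z0.
Proof.
move=> r0 cu u0 lapu yr rho0 rhor mu0 muu z0r.
have k3 : 0 < k.+3%:R + - 2^-1 - 2 :> R.
  by rewrite -[k.+3]addn3 natrD; have := ler0n R k; lra.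
pose M := mu * rho ^+ k.+1.
have M0 : 0 <= M by rewrite mulr_ge0 // exprn_ge0 // ltW.
pose F (e : R) : R := e `^ (- k.+1%:R).
have FE e : 0 <= e -> F e = (e ^+ k.+1)^-1 by exact: powR_invn.
have Fle e e' : 0 < e -> e <= e' -> F e' <= F e.
  move=> e0 ee'; have e'0 := lt_le_trans e0 ee'.
  rewrite (FE _ (ltW e0)) (FE _ (ltW e'0)) lef_pV2 ?posrE ?exprn_gt0 //.
  by rewrite lerXn2r // nnegrE ltW.
have F0 e : 0 <= F e by exact: powR_ge0.
have r80 : 0 < 7 * r / 8 by lra.
have r58 : 0 < 5 * r / 8 by lra.
rewrite -(FE _ (ltW r58)) -(FE _ (ltW r80)) -/M.
(* The distance from [y] is at most r/2 + r/8 at [z0] and at least r - r/8 on the outer sphere;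
   hence 5/8 and 7/8. *)
have z0y : enorm (z0 - y) <= 5 * r / 8.
  by have := enormD z0 (- y); rewrite enormN; lra.
have z0y' : rho <= enorm (z0 - y).
  have := enormB_le z0 y 0; rewrite !subr0; lra.
apply: (@le_trans _ _ (M * (F (enorm (z0 - y)) - F (7 * r / 8)))).
  by rewrite ler_wpM2l // lerD2r; apply: Fle => //; lra.
(* The auxiliary term takes an arbitrarily small value [e] at [z0]. *)
apply/ler_addgt0Pr => e e0.
pose G (z : 'rV[R]_k.+3) : R := enorm (z - 0) `^ (- 2^-1).
have Gz0 : 0 < G z0 by apply: powR_gt0; rewrite subr0; lra.
pose eps := e / G z0.
have eps0 : 0 < eps by rewrite divr_gt0.
pose w z := u z + (- M) * F (enorm (z - y)) + M * F (7 * r / 8) + eps * G z.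
suff : 0 <= w z0.
  by rewrite /w /eps divfK ?gt_eqF // mulrBr; lra.
(* On the inner sphere, of radius [s ^+ 2], [G] equals [s^-1], so the first bound on [s] gives
   [mu <= eps * G z]; the other two keep [z0] outside that sphere. *)
pose s := Num.min (eps / (mu + 1)) (Num.min 1 (r / 4)).
have s0 : 0 < s.
  by rewrite /s !lt_min ltr01 !divr_gt0 //; lra.
have s_eps : s <= eps / (mu + 1) by rewrite ge_min lexx.
have s1 : s <= 1 by rewrite !ge_min lexx orbT.
have sr : s <= r / 4 by rewrite !ge_min lexx !orbT.
have s2 : s ^+ 2 <= r / 4 by nra.
have s20 : 0 < s ^+ 2 by rewrite exprn_gt0.
pose K := [set z : 'rV[R]_k.+3 | s ^+ 2 <= enorm (z - 0)] `&`
          [set z | enorm (z - 0) <= r] `&` [set z | rho <= enorm (z - y)].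
apply: (@minimum_principle _ _ K).
- apply: closedI; first apply: closedI.
  + by apply: closed_ge_continuous; exact: continuous_enormB.
  + by apply: closed_le_continuous; exact: continuous_enormB.
  + by apply: closed_ge_continuous; exact: continuous_enormB.
- by apply: (@bounded_enorm_ball _ _ 0 r) => z [[_ ?] _].
- move=> z [[/= z1 z2] z3].
  have z10 : 0 < enorm (z - 0) by lra.
  have zy0 : 0 < enorm (z - y) by lra.
  rewrite subr0 in z2; have z10' := z10; rewrite subr0 in z10'.
  have c1 := cu z z10' z2.
  have c2 := continuous_powR_enormB (a := - k.+1%:R) zy0.
  have c3 := continuous_powR_enormB (a := - 2^-1) z10.
  exact: (continuous_affine3 c1 c2 c3).
- move=> z [[/= z1 z2] z3].
  have z10 : 0 < enorm (z - 0) by lra.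
  have zy0 : 0 < enorm (z - y) by lra.
  have uz : 0 <= u z by apply: u0; rewrite -[z]subr0.
  have Gz : 0 <= eps * G z by rewrite mulr_ge0 ?powR_ge0 ?ltW.
  have MF : 0 <= M * F (7 * r / 8) by rewrite mulr_ge0.
  have MFmu : M * F (enorm (z - y)) <= mu.
    apply: (@le_trans _ _ (M * F rho)).
      by rewrite ler_wpM2l //; exact: Fle.
    by rewrite (FE _ (ltW rho0)) /M mulfK // gt_eqF // exprn_gt0.
  (* The sign is checked on the inner sphere, the outer sphere and the sphere about [y] in turn; all
     other points of [K] are interior. *)
  have [z1'|z1'] := leP (enorm (z - 0)) (s ^+ 2).
    left; have -> : w z = u z + M * F (7 * r / 8) +
      (eps * G z - M * F (enorm (z - y))) by rewrite /w; ring.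
    suff : mu <= eps * G z by lra.
    have -> : G z = s^-1.
      rewrite /G; have -> : enorm (z - 0) = s ^+ 2.
        by apply/le_anti; rewrite z1 z1'.
      rewrite -powR_mulrn ?ltW // -powRrM mulrN mulfV //.
      by rewrite powR_inv1 // ltW.
    rewrite ler_pdivlMr //.
    move: s_eps; rewrite ler_pdivlMr; last by lra.
    nra.
  have [z2'|z2'] := leP r (enorm (z - 0)).
    left; suff : M * F (enorm (z - y)) <= M * F (7 * r / 8) by rewrite /w; lra.
    rewrite ler_wpM2l //; apply: Fle => //.
    have := enormB_le z y 0; rewrite !subr0; rewrite subr0 in z2'; lra.
  have [z3'|z3'] := leP (enorm (z - y)) rho.
    left; suff : mu <= u z by rewrite /w; lra.
    apply: muu; last by apply/le_anti; rewrite z3 z3'.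
    by rewrite -enorm_gt0 -[z]subr0.
  right.
  have [a da sa] : exists2 a : 'I_k.+3 -> R,
     forall i, diff2_at0 (fun t => u (z + t *: delta_mx ord0 i)) (a i) &
     \sum_i a i <= 0.
    by apply: lapu; rewrite -[z]subr0.
  have [b db sb] := diff2_slices_powR (- k.+1%:R) zy0.
  have [c dc sc] := diff2_slices_powR (- 2^-1) z10.
  exists (fun i => a i + (- M) * b i + 0 + eps * c i); split.
  + move=> i; near=> t; split; first split => /=.
    * apply: ltW; near: t.
      exact: (near_line _ (@continuous_enormB _ _ 0 _) z1').
    * rewrite -lerN2; apply: ltW; near: t.
      apply: (@near_line _ _ (fun z => - enorm (z - 0))); last by rewrite ltrN2.
      by apply: continuousN; exact: continuous_enormB.
    * apply: ltW; near: t.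
      exact: (near_line _ (@continuous_enormB _ _ y _) z3').
  + have D0 : diff2_at0 (fun=> M * F (7 * r / 8)) 0.
      have := diff2_at0_quad (M * F (7 * r / 8)) 0 0; rewrite mulr0.
      by congr (diff2_at0 _ _); apply/funext => t; rewrite !mul0r !addr0.
    by move=> i; exact: (diff2_at0D (diff2_at0D (diff2_at0D (da i)
      (diff2_at0Z (- M) (db i))) D0) (diff2_at0Z eps (dc i))).
  + rewrite !big_split /= big1_eq addr0 -!mulr_sumr sb sc.
    (* The term with pole [y] is harmonic; strict negativity comes from the auxiliary power
       alone. *)
    have -> : k.+3%:R + - k.+1%:R - 2 = 0 :> R.
      by rewrite -[k.+3]addn2 natrD -[k.+1]addn1 natrD; ring.
    rewrite mulr0 mul0r mulr0 addr0.
    rewrite -[ltRHS]addr0; apply: ler_ltD => //.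
    rewrite pmulr_rlt0 // pmulr_llt0 ?powR_gt0 // mulNr oppr_lt0 mulr_gt0 //.
- by split; [split|]; rewrite /= ?subr0 ?z0r //; lra.
Unshelve. all: by end_near. Qed.

(** * Interior gradient estimate *)

(* Comparison of [(v - v \o sigma) / 2] with a quadratic barrier on a half ball,
   where [sigma] is the reflection in the hyperplane [z_i = y_i]. *)
Lemma partial_le_comparison (R : realType) n (y : 'rV[R]_n) (f : 'rV[R]_n -> R)
    (rho S K : R) (i : 'I_n) (d : R) :
  0 < rho -> 0 < S -> 0 <= K ->
  (forall z, enorm (z - y) <= rho -> {for z, continuous f}) ->
  (forall z, enorm (z - y) <= rho -> `|f z| <= S) ->
  (forall z, enorm (z - y) < rho -> exists2 a : 'I_n -> R,
     forall j, diff2_at0 (fun t => f (z + t *: delta_mx ord0 j)) (a j) &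
     `|\sum_j a j| <= K) ->
  is_derive (0 : R) (1 : R) (fun t => f (y + t *: delta_mx ord0 i)) d ->
  d <= n.+1%:R * S / rho + K * rho.
Proof.
move=> rho0 S0 K0 cf fS lapf df.
(* [A] makes the barrier at least [S] on the sphere; [gam] makes its Laplacian [- 2 * K - 2 * A],
   while [f] and its reflection contribute at most [K]. *)
pose A := S / rho ^+ 2.
have A0 : 0 < A by rewrite divr_gt0 ?exprn_gt0.
have ArS : A * rho ^+ 2 = S by rewrite divfK // gt_eqF // exprn_gt0.
pose gam := K + n.+1%:R * A.
have gam0 : 0 < gam by rewrite ltr_wpDl // mulr_gt0.
pose e j : 'rV[R]_n := delta_mx ord0 j.
pose sig (z : 'rV[R]_n) : 'rV[R]_n := z + (- 2 * (z - y) ord0 i) *: e i.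
have sig_norm z : enorm (sig z - y) = enorm (z - y).
  apply/eqP; rewrite -(@eqrXn2 _ 2) ?enorm_ge0 //; apply/eqP.
  by rewrite /sig addrAC sqr_enormD_delta; ring.
have coordD z t j :
    (z + t *: e j - y) ord0 i = (z - y) ord0 i + t * (j == i)%:R.
  by rewrite !mxE eqxx (eq_sym i); ring.
(* Reflection reverses slices in direction [i] and keeps the direction of the others; second
   derivatives do not see the reversal. *)
have sig_slice z t j :
    sig (z + t *: e j) = sig z + ((if j == i then - 1 else 1) * t) *: e j.
  rewrite /sig coordD; have [->|ji] := eqVneq j i.
    by rewrite mulr1 -!addrA -!scalerDl; congr (_ + _ *: _); ring.
  by rewrite mulr0 addr0 mul1r addrAC.
have cont_coord : continuous (fun z : 'rV[R]_n => (z - y) ord0 i).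
  exact: continuous_coordB.
have cont_sig : continuous sig.
  move=> z.
  have cz : {for z, continuous (fun z : 'rV[R]_n => - 2 * (z - y) ord0 i)}.
    exact: (cvgMl_tmp (cont_coord z)).
  have cs : {for z, continuous
      (fun z : 'rV[R]_n => (- 2 * (z - y) ord0 i) *: e i)}.
    exact: (@cvgZr_tmp R 'rV[R]_n _ _ _ _ _ (e i) cz).
  exact: (@continuousD R 'rV[R]_n 'rV[R]_n id _ z (@cvg_id _ (nbhs z)) cs).
(* The barrier vanishes at [y], is nonnegative on the half ball, and has slope [gam * rho] at [y] in
   direction [i], which is the asserted bound. *)
pose Q (z : 'rV[R]_n) : R := A * enorm (z - y) ^+ 2 +
  (z - y) ord0 i * (gam * rho - gam * (z - y) ord0 i).
have cont_Q : continuous Q.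
  move=> z.
  have c1 : {for z, continuous (fun x : 'rV[R]_n => enorm (x - y) ^+ 2)}.
    apply: (@continuous_comp _ _ _ _ (fun x : R => x ^+ 2)).
      exact: continuous_enormB.
    exact: exprn_continuous.
  exact: (@cvgD R R _ _ _ _ _ _ _ (cvgMl_tmp c1) (cvgM (cont_coord z)
    (cvgB (cvg_cst _) (cvgMl_tmp (cont_coord z))))).
(* The summand [0] gives [w] the shape of [continuous_affine3]. *)
pose w (z : 'rV[R]_n) : R := Q z + (- 2^-1) * f z + 0 + 2^-1 * f (sig z).
pose H := [set z : 'rV[R]_n | enorm (z - y) <= rho] `&`
          [set z | 0 <= (z - y) ord0 i].
have w_ge0 : forall z, H z -> 0 <= w z.
  apply: minimum_principle.
  - apply: closedI.
      by apply: closed_le_continuous; exact: continuous_enormB.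
    exact: closed_ge_continuous.
  - by apply: (@bounded_enorm_ball _ _ y rho) => z [].
  - move=> z [/= z1 z2].
    have c3 : {for z, continuous (f \o sig)}.
      apply: continuous_comp; first exact: cont_sig.
      by apply: cf; rewrite sig_norm.
    exact: (continuous_affine3 (cont_Q z) (cf z z1) c3).
  - move=> z [/= z1 z2].
    have fz := fS z z1.
    have fsz : `|f (sig z)| <= S by apply: fS; rewrite sig_norm.
    have zi : (z - y) ord0 i <= rho.
      by apply: le_trans z1; apply: le_trans (normr_coord_enorm _ i); exact: ler_norm.
    have Q1 : 0 <= (z - y) ord0 i * (gam * rho - gam * (z - y) ord0 i).
      by rewrite -mulrBr !mulr_ge0 ?subr_ge0 // ltW.
    (* On the flat face the two values of [f] cancel; on the spherical face the barrier dominates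
       their half difference, which is at most [S]. *)
    have [z2'|z2'] := leP ((z - y) ord0 i) 0.
      left; have zi0 : (z - y) ord0 i = 0 by apply/le_anti; rewrite z2 z2'.
      have sz : sig z = z by rewrite /sig zi0 mulr0 scale0r addr0.
      rewrite /w sz.
      have : 0 <= Q z.
        by rewrite /Q addr_ge0 // mulr_ge0 ?exprn_ge0 ?enorm_ge0 ?ltW.
      lra.
    have [z1'|z1'] := leP rho (enorm (z - y)).
      left; have zr : enorm (z - y) = rho by apply/le_anti; rewrite z1 z1'.
      have QS : S <= Q z by rewrite /Q zr ArS lerDl.
      move: fz fsz; rewrite !ler_norml /w => /andP[_ f1] /andP[f2 _].
      move: (Q z) (f z) (f (sig z)) f1 f2 QS {zr Q1 z1'} => q a b; lra.
    right.
    have [a da sa] := lapf z z1'.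
    have [b db sb] : exists2 a : 'I_n -> R,
       forall j, diff2_at0 (fun t => f (sig z + t *: delta_mx ord0 j)) (a j) &
       `|\sum_j a j| <= K by apply: lapf; rewrite sig_norm.
    exists (fun j =>
      2 * (A - gam * (j == i)%:R) + (- 2^-1) * a j + 0 + 2^-1 * b j).
    split.
    + move=> j; near=> t; split => /=.
        rewrite -lerN2; apply: ltW; near: t.
        apply: (@near_line _ _ (fun z => - enorm (z - y))); last by rewrite ltrN2.
        by apply: continuousN; exact: continuous_enormB.
      by apply: ltW; near: t; exact: (near_line _ (cont_coord _) z2').
    + move=> j.
      have dQ : diff2_at0 (fun t => Q (z + t *: delta_mx ord0 j))
          (2 * (A - gam * (j == i)%:R)).
        have := diff2_at0_quad (Q z) (A * (2 * (z - y) ord0 j) +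
          (j == i)%:R * (gam * rho - 2 * gam * (z - y) ord0 i))
          (A - gam * (j == i)%:R).
        congr (diff2_at0 _ _); apply/funext => t.
        rewrite /Q coordD (addrAC z) sqr_enormD_delta.
        by case: (j == i) => /=; ring.
      have ds : diff2_at0 (fun t => f (sig (z + t *: delta_mx ord0 j))) (b j).
        have := db j; have [ji|ji] := boolP (j == i).
          move=> /diff2_at0_opp; congr (diff2_at0 _ _); apply/funext => t.
          by rewrite sig_slice ji mulN1r.
        congr (diff2_at0 _ _); apply/funext => t.
        by rewrite sig_slice (negbTE ji) mul1r.
      have D0 : diff2_at0 (fun=> 0 : R) 0.
        have := @diff2_at0_quad R 0 0 0; rewrite mulr0.
        by congr (diff2_at0 _ _); apply/funext => t; rewrite !mul0r !addr0.
      exact: (diff2_at0D (diff2_at0D (diff2_at0D dQ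
        (diff2_at0Z (- 2^-1) (da j))) D0) (diff2_at0Z 2^-1 ds)).
    + rewrite !big_split /= big1_eq addr0 -!mulr_sumr sumrB sumr_const card_ord.
      rewrite -mulr_sumr.
      have -> : \sum_(j < n) (j == i)%:R = 1 :> R.
        rewrite (bigD1 i) //= eqxx big1 ?addr0 // => j /negbTE -> //.
      rewrite mulr1 /gam.
      have -> : A *+ n = n%:R * A by rewrite mulr_natl.
      have -> : n.+1%:R = n%:R + 1 :> R by rewrite natr1.
      move: sa sb; rewrite !ler_norml => /andP[sa _] /andP[_ sb].
      move: (\sum_j a j) (\sum_j b j) (n%:R : R) sa sb => p q n'.
      move=> Kp qK; clear -A0 K0 Kp qK; move: A A0 => A'; lra.
(* If [d] exceeded [gam * rho], then [k], the restriction of [w] to the axis through [y], would be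
   negative just to the right of [0], since [k 0 = 0]. *)
rewrite leNgt; apply/negP => dlt.
pose g t := f (y + t *: e i).
pose k t := gam * rho * t + (A - gam) * t ^+ 2 + (- 2^-1) * g t + 2^-1 * g (- t).
have dk : is_derive (0 : R) (1 : R) k (gam * rho - d).
  have dg' : is_derive (0 : R) (1 : R) (fun t => g (- t)) (- d).
    rewrite -mulrN1; apply: (@is_derive1_comp R g (fun t => - t) 0 _ (-1)).
    by rewrite oppr0.
  have dg : is_derive (0 : R) (1 : R) g d := df.
  by apply: is_derive_eq; rewrite /GRing.scale /=; field.
have gr : gam * rho = n.+1%:R * S / rho + K * rho.
  by rewrite /gam /A; field; rewrite gt_eqF.
have [|h h0 kneg] := is_derive_lt0_right dk; first by rewrite gr; lra.
pose t := Num.min (h / 2) rho.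
have t0 : 0 < t by rewrite lt_min rho0 andbT; lra.
have th : t < h by rewrite gt_min; apply/orP; left; lra.
have tr : t <= rho by rewrite ge_min lexx orbT.
have yt : y + t *: e i - y = t *: e i by rewrite addrAC subrr add0r.
have yti : (y + t *: e i - y) ord0 i = t.
  by rewrite yt !mxE !eqxx mulr1.
have ytn : enorm (y + t *: e i - y) ^+ 2 = t ^+ 2.
  by rewrite yt -[t *: _]add0r sqr_enormD_delta enorm0 mxE; ring.
have : 0 <= w (y + t *: e i).
  apply: w_ge0; split => /=; last by rewrite yti ltW.
  suff -> : enorm (y + t *: e i - y) = t by [].
  by apply/eqP; rewrite -(@eqrXn2 _ 2) ?enorm_ge0 ?ltW // ytn.
have st : sig (y + t *: e i) = y + (- t) *: e i.
  by rewrite /sig yti -addrA -scalerDl; congr (_ + _ *: _); ring.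
rewrite /w /Q ytn yti st -/(g t) -/(g (- t)).
have := kneg t t0 th; rewrite {2}/k oppr0 {1}/k.
move: (g t) (g (- t)) (g 0) => g1 g2 g3; lra.
Unshelve. all: by end_near. Qed.

Lemma is_derive_partial_slice (R : realType) n (f : 'rV[R]_n -> R)
    (y : 'rV[R]_n) i :
  derivable f y (delta_mx ord0 i) ->
  is_derive (0 : R) (1 : R) (fun t => f (y + t *: delta_mx ord0 i))
    (partial i f y).
Proof.
have y0 : y + (0 : R) *: delta_mx ord0 i = y by rewrite scale0r addr0.
have := @is_derive_slice R n f y (delta_mx ord0 i) 0; by rewrite y0.
Qed.

(** The one-sided bound for [f] and for its opposite controls each partial derivative; the factor
    [n%:R] comes from bounding the Euclidean norm by the sum of the absolute values of the
    coordinates. *)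
Lemma enorm_grad_le (R : realType) n (y : 'rV[R]_n) (f : 'rV[R]_n -> R)
    (rho S K : R) :
  0 < rho -> 0 < S -> 0 <= K ->
  (forall i, derivable f y (delta_mx ord0 i)) ->
  (forall z, enorm (z - y) <= rho -> {for z, continuous f}) ->
  (forall z, enorm (z - y) <= rho -> `|f z| <= S) ->
  (forall z, enorm (z - y) < rho -> exists2 a : 'I_n -> R,
     forall j, diff2_at0 (fun t => f (z + t *: delta_mx ord0 j)) (a j) &
     `|\sum_j a j| <= K) ->
  enorm (grad f y) <= n%:R * (n.+1%:R * S / rho + K * rho).
Proof.
move=> rho0 S0 K0 df cf fS lapf; apply: le_trans (enorm_le_sum _) _.
rewrite mulr_natl -[n in _ *+ n]card_ord -sumr_const.
apply: ler_sum => i _; rewrite mxE ler_norml; apply/andP; split.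
  rewrite lerNl.
  apply: (@partial_le_comparison _ _ y (fun z => (- 1) * f z) _ _ _ i) => //.
  - by move=> z zr; exact: (cvgMl_tmp (cf z zr)).
  - by move=> z zr; rewrite mulN1r normrN; exact: fS.
  - move=> z zr; have [a da sa] := lapf z zr.
    exists (fun j => (- 1) * a j); last by rewrite -mulr_sumr mulN1r normrN.
    by move=> j; exact: diff2_at0Z.
  - have := @is_deriveZ R R^o R^o _ (- 1) _ _ _ (is_derive_partial_slice (df i)).
    by rewrite [- 1 *: _]mulN1r.
apply: (@partial_le_comparison _ _ y f _ _ _ i) => //.
exact: is_derive_partial_slice.
Qed.

(** * Oscillation bounds from partial derivatives *)

Lemma ler_enorm (R : realType) n (x y : 'rV[R]_n) :
  (forall i, `|x ord0 i| <= `|y ord0 i|) -> enorm x <= enorm y.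
Proof.
move=> xy; rewrite /enorm ler_sqrt; last first.
  by apply: sumr_ge0 => i _; exact: sqr_ge0.
by apply: ler_sum => i _; rewrite -(real_normK (num_real (x _ _)))
  -(real_normK (num_real (y _ _))) ler_sqr ?nnegrE.
Qed.

Lemma normr_diff_le_derive (R : realType) (g g' : R -> R) (c G : R) :
  (forall s, `|s| <= `|c| -> is_derive s (1 : R) g (g' s) /\ `|g' s| <= G) ->
  `|g c - g 0| <= G * `|c|.
Proof.
move=> dg.
have cont (a b : R) : (forall s, s \in `[a, b] -> `|s| <= `|c|) ->
    {within `[a, b], continuous g}.
  move=> ab; apply: derivable_within_continuous => s /ab /dg[d _].
  by case: d.
have seg (a b : R) : a <= b ->
    (forall s, s \in `[a, b] -> `|s| <= `|c|) -> `|g b - g a| <= G * (b - a).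
  move=> ab in_c.
  have [s /subset_itv_oo_cc /in_c sc|s sc ->] :=
      @MVT_segment _ g g' a b ab _ (cont _ _ in_c); first exact: (dg s sc).1.
  rewrite normrM [`|b - a|]ger0_norm ?subr_ge0 // ler_wpM2r ?subr_ge0 //.
  exact: (dg s (in_c s sc)).2.
have [c0|c0] := leP 0 c.
  have := seg 0 c c0; rewrite subr0 ger0_norm //; apply => s.
  by rewrite in_itv /= => /andP[? ?]; rewrite ger0_norm.
have := seg c 0 (ltW c0); rewrite sub0r distrC ltr0_norm //; apply => s.
by rewrite in_itv /= => /andP[? ?]; rewrite ler0_norm // lerN2.
Qed.

(** Going from [y] to [z] one coordinate at a time stays in the ball and costs at most [G * rho] per
    coordinate. *)
Lemma normr_diff_le_partial (R : realType) n (y z : 'rV[R]_n)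
    (f : 'rV[R]_n -> R) (rho G : R) :
  (forall x, enorm (x - y) <= rho -> forall i,
     derivable f x (delta_mx ord0 i) /\ `|partial i f x| <= G) ->
  enorm (z - y) <= rho -> `|f z - f y| <= n%:R * (G * rho).
Proof.
move=> df zr.
pose P (m : nat) : 'rV[R]_n :=
  y + \row_i (if (i < m)%N then (z - y) ord0 i else 0).
have P0 : P 0%N = y by apply/rowP => i; rewrite !mxE addr0.
have Pn : P n = z by apply/rowP => i; rewrite !mxE ltn_ord; ring.
suff : forall m, (m <= n)%N -> `|f (P m) - f y| <= m%:R * (G * rho).
  by move=> /(_ n (leqnn n)); rewrite Pn.
elim=> [_|m IH mn]; first by rewrite P0 subrr normr0 mul0r.
pose i := Ordinal mn; pose c := (z - y) ord0 i.
have PS : P m.+1 = P m + c *: delta_mx ord0 i.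
  apply/rowP => j; rewrite !mxE eqxx /= -addrA; congr (_ + _).
  have [->|ji] := eqVneq j i; first by rewrite /= ltnSn ltnn mulr1 add0r /c !mxE.
  have jm : (j == m :> nat) = false.
    by apply: contra_neqF ji => /eqP jm; exact: val_inj.
  by rewrite mulr0 addr0 ltnS leq_eqVlt jm.
have step : `|f (P m.+1) - f (P m)| <= G * rho.
  have G0 : 0 <= G.
    apply: le_trans (df y _ i).2 => //.
    by rewrite subrr enorm0 (le_trans (enorm_ge0 _) zr).
  have dg s : `|s| <= `|c| ->
      is_derive s (1 : R) (fun s => f (P m + s *: delta_mx ord0 i))
        (partial i f (P m + s *: delta_mx ord0 i)) /\
      `|partial i f (P m + s *: delta_mx ord0 i)| <= G.
    move=> sc; have [] := df (P m + s *: delta_mx ord0 i) _ i; last first.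
      move=> d dG; split; last exact: dG.
      exact: (@is_derive_slice R n f (P m) (delta_mx ord0 i) s d).
    (* Each coordinate of the difference to [y] is dominated by that of [z - y], so the segment
       stays in the ball. *)
    apply: le_trans zr; apply: ler_enorm => j.
    have -> : (P m + s *: delta_mx ord0 i - y) ord0 j =
        (if (j < m)%N then (z - y) ord0 j else 0) + s * (j == i)%:R.
      by rewrite !mxE eqxx /=; ring.
    have [->|ji] := eqVneq j i; first by rewrite ltnn add0r mulr1.
    by rewrite mulr0 addr0; case: ifP => // _; rewrite normr0.
  have := normr_diff_le_derive dg; rewrite scale0r addr0 -PS => /le_trans; apply.
  by rewrite ler_wpM2l // (le_trans (normr_coord_enorm _ i)).
rewrite -natr1 mulrDl mul1r -[f (P m.+1) - _](subrKA (f (P m))) addrC.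
apply: le_trans (ler_normD _ _) _; rewrite lerD //.
exact: IH (ltnW mn).
Qed.

(** * Weighted maxima and the two cases of the scaling argument *)

(** [l] is the larger of the two values giving equality in one of the bounds. *)
Lemma common_scale (R : realType) (A B L : R) m :
  0 < A -> 0 <= B -> 0 < L ->
  exists2 l, 0 < l &
    [/\ A <= (L * l) ^+ m.+1, B <= l ^+ m.+2 &
        A = (L * l) ^+ m.+1 \/ B = l ^+ m.+2].
Proof.
move=> A0 B0 L0.
have root (x : R) j : 0 <= x -> (x `^ j.+1%:R^-1) ^+ j.+1 = x.
  by move=> x0; rewrite -powR_mulrn ?powR_ge0 // -powRrM mulVf ?powRr1 // pnatr_eq0.
pose a := A `^ m.+1%:R^-1 / L; pose b := B `^ m.+2%:R^-1.
have a0 : 0 < a by rewrite divr_gt0 // powR_gt0.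
have aE : (L * a) ^+ m.+1 = A by rewrite /a mulrC divfK ?gt_eqF // root // ltW.
have bE : b ^+ m.+2 = B by rewrite root.
have b0 : 0 <= b by exact: powR_ge0.
have [ab|/ltW ba] := leP a b.
  have b0' := lt_le_trans a0 ab.
  exists b => //; split; rewrite ?bE; [|exact: lexx|by right].
  by rewrite -aE lerXn2r ?nnegrE ?(mulr_ge0 (ltW L0)) ?ler_wpM2l // ltW.
exists a => //; split; rewrite ?aE; [exact: lexx| |by left].
by rewrite -bE lerXn2r // nnegrE ltW.
Qed.

(** The weight is a power of the distance to the boundary sphere; for positive [m] it vanishes
    there, so a positive maximum is attained inside. *)
Lemma weighted_max (R : realType) n (f : 'rV[R]_n -> R) (x : 'rV[R]_n)
    (delta : R) m :
  0 <= delta ->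
  (forall z, enorm (z - x) <= delta -> {for z, continuous f}) ->
  exists2 y, enorm (y - x) <= delta &
    forall z, enorm (z - x) <= delta ->
      (delta - enorm (z - x)) ^+ m * f z <= (delta - enorm (y - x)) ^+ m * f y.
Proof.
move=> delta0 cf; pose K := [set z : 'rV[R]_n | enorm (z - x) <= delta].
have Kx : K x by rewrite /K /= subrr enorm0.
have cK : compact K.
  apply: bounded_closed_compact; first exact: (@bounded_enorm_ball _ _ x delta).
  by apply: closed_le_continuous; exact: continuous_enormB.
have cw : {within K, continuous
    (fun z : 'rV[R]_n => (delta - enorm (z - x)) ^+ m * f z)}.
  apply: continuous_in_subspaceT => z /set_mem Kz.
  have c1 : {for z, continuous
      (fun z : 'rV[R]_n => (delta - enorm (z - x)) ^+ m)}.
    apply: (@continuous_comp _ _ _ (fun z : 'rV[R]_n => delta - enorm (z - x))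
      (fun y => y ^+ m)); last exact: exprn_continuous.
    exact: (@cvgB R R _ _ _ _ _ _ _ (cvg_cst _) (@continuous_enormB _ _ x z)).
  exact: (cvgM c1 (cf z Kz)).
have [|y /set_mem Ky ymax] := EVT_max_rV _ cK cw; first by exists x.
by exists y => // z Kz; exact: ymax (mem_set Kz).
Qed.

Lemma continuous_sqrt_sum (R : realType) (T : topologicalType) n
    (g : 'I_n -> T -> R) (z : T) :
  (forall i, {for z, continuous (g i)}) ->
  {for z, continuous (fun x => Num.sqrt (\sum_i g i x ^+ 2))}.
Proof.
move=> cg.
apply: (@continuous_comp _ _ _ (fun x => \sum_i g i x ^+ 2) (@Num.sqrt R)); last first.
  exact: sqrt_continuous.
apply: cvg_big => [|i _]; first exact: add_continuous.
apply: (@continuous_comp _ _ _ (g i) (fun y : R => y ^+ 2)); first exact: cg.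
exact: exprn_continuous.
Qed.

Lemma continuous_enorm_grad (R : realType) n (f : 'rV[R]_n -> R) (z : 'rV[R]_n) :
  (forall i, {for z, continuous (partial i f)}) ->
  {for z, continuous (fun z => enorm (grad f z))}.
Proof.
move=> cf.
have -> : (fun z => enorm (grad f z)) =
    (fun x : 'rV[R]_n => Num.sqrt (\sum_i partial i f x ^+ 2)).
  by apply/funext => x; rewrite /enorm; under eq_bigr do rewrite mxE.
exact: continuous_sqrt_sum.
Qed.

(** The case where the height of [u] sets the scale: [u] stays above [u y / 2] on the ball of radius
    [l^-1], and the last hypothesis is applied with this value as [mu]. *)
Lemma height_bound (R : realType) k (u : 'rV[R]_k.+3 -> R) (y : 'rV[R]_k.+3)
    (L l C : R) :
  0 < l -> 0 <= L -> 2 ^+ k.+3 * k.+3%:R <= L ^+ k.+1 ->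
  u y = (L * l) ^+ k.+1 ->
  (forall x, enorm (x - y) <= l^-1 -> forall i,
     derivable u x (delta_mx ord0 i) /\ `|partial i u x| <= (2 * l) ^+ k.+2) ->
  (forall mu, 0 <= mu -> (forall z, enorm (z - y) = l^-1 -> mu <= u z) ->
     mu * l^-1 ^+ k.+1 <= C) ->
  L ^+ k.+1 <= 2 * C.
Proof.
move=> l0 L0 hL uy du HC.
have lk0 : 0 < l ^+ k.+1 by rewrite exprn_gt0.
have Hosc z : enorm (z - y) <= l^-1 -> `|u z - u y| <= u y / 2.
  move=> zy; apply: le_trans (normr_diff_le_partial du zy) _.
  (* With N = [k.+3], [hL] says that N (2 l)^(N-1) / l is at most half of (L l)^(N-2). *)
  have -> : (2 * l) ^+ k.+2 * l^-1 = 2 ^+ k.+2 * l ^+ k.+1.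
    by rewrite exprMn [l ^+ k.+2]exprSr !mulrA mulfK // gt_eqF.
  rewrite uy exprMn; move: hL; rewrite exprS; move: lk0.
  move: (l ^+ _) (2 ^+ _) (L ^+ _) k.+3%:R => P T M n; nra.
have uy0 : 0 <= u y by rewrite uy exprn_ge0 // mulr_ge0 // ltW.
have := HC (u y / 2); have -> : u y / 2 * l^-1 ^+ k.+1 = L ^+ k.+1 / 2.
  rewrite uy exprMn exprVn mulrAC mulfK // gt_eqF //.
move=> H; suff : L ^+ k.+1 / 2 <= C by lra.
apply: H; first by rewrite divr_ge0.
move=> z zy; have := Hosc z; rewrite zy lexx => /(_ isT).
by rewrite ler_norml => /andP[+ _]; lra.
Qed.

(** The case where the gradient sets the scale. In the gradient estimate at radius [s / l], the
    choice of [s] turns the term coming from the size of [u] into a quarter of the left side; the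
    other term leaves a bound on a power of [l] whose exponent is positive by the assumption on [p]
    and [q]. *)
Lemma gradient_scale_bound (R : realType) k (u : 'rV[R]_k.+3 -> R)
    (y : 'rV[R]_k.+3) (p q L l s : R) :
  0 <= p -> 0 <= q -> k.+1%:R * p + k.+2%:R * q < k.+3%:R ->
  0 < l -> 0 < L -> s = 4 * k.+3%:R * k.+4%:R * (2 * L) ^+ k.+1 ->
  enorm (grad u y) = l ^+ k.+2 ->
  (forall z, enorm (z - y) <= s / l -> [/\ {for z, continuous u},
     forall i, derivable u z (delta_mx ord0 i) & `|u z| <= (2 * L * l) ^+ k.+1]) ->
  (forall z, enorm (z - y) < s / l -> exists2 a : 'I_k.+3 -> R,
     forall j, diff2_at0 (fun t => u (z + t *: delta_mx ord0 j)) (a j) &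
     `|\sum_j a j| <= ((2 * L * l) ^+ k.+1) `^ p * ((2 * l) ^+ k.+2) `^ q) ->
  l <= (2 * k.+3%:R * s * (((2 * L) ^+ k.+1) `^ p * (2 ^+ k.+2) `^ q)) `^
        (k.+3%:R - (k.+1%:R * p + k.+2%:R * q))^-1.
Proof.
move=> p0 q0 hpq l0 L0 sE gy regu lapu.
set sg := k.+1%:R * p + k.+2%:R * q in hpq *.
set CK := _ `^ p * _ `^ q.
have L20 : 0 < (2 * L) ^+ k.+1 by rewrite exprn_gt0 // mulr_gt0.
have s0 : 0 < s by rewrite sE !mulr_gt0.
have rho0 : 0 < s / l by rewrite divr_gt0.
have S0 : 0 < (2 * L * l) ^+ k.+1 by rewrite exprn_gt0 // !mulr_gt0.
have KE : ((2 * L * l) ^+ k.+1) `^ p * ((2 * l) ^+ k.+2) `^ q = CK * l `^ sg.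
  have pow (x e : R) m : 0 <= x ->
      ((x * l) ^+ m) `^ e = (x ^+ m) `^ e * l `^ (m%:R * e).
    move=> x0; rewrite exprMn powRM ?exprn_ge0 //; last exact: ltW.
    by rewrite -(powR_mulrn m (ltW l0)) -powRrM.
  rewrite !pow // ?mulr_ge0 ?(ltW L0) //.
  by rewrite mulrACA -powRD // (gt_eqF l0) implybT.
have K0 : 0 <= CK * l `^ sg by rewrite !mulr_ge0 ?powR_ge0.
have dy i : derivable u y (delta_mx ord0 i).
  by have [] := regu y; rewrite ?subrr ?enorm0 ?(ltW rho0).
rewrite KE in lapu.
have := @enorm_grad_le _ _ y u (s / l) ((2 * L * l) ^+ k.+1) (CK * l `^ sg)
  rho0 S0 K0 dy _ _ lapu.
have H1 z : enorm (z - y) <= s / l -> {for z, continuous u} by move=> /regu[].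
have H2 z : enorm (z - y) <= s / l -> `|u z| <= (2 * L * l) ^+ k.+1.
  by move=> /regu[].
move=> /(_ H1 H2); rewrite gy.
have -> : k.+3%:R * (k.+4%:R * (2 * L * l) ^+ k.+1 / (s / l) +
    CK * l `^ sg * (s / l)) = l ^+ k.+2 / 4 + k.+3%:R * CK * s * (l `^ sg / l).
  rewrite mulrDr; congr (_ + _); last by rewrite !mulrA; congr (_ / _); ring.
  rewrite sE (exprMn _ _ l) [l ^+ k.+2]exprSr.
  have k3 : k.+3%:R != 0 :> R by rewrite pnatr_eq0.
  have k4 : k.+4%:R != 0 :> R by rewrite pnatr_eq0.
  move: (lt0r_neq0 L20) (lt0r_neq0 l0) k3 k4.
  move: ((2 * L) ^+ k.+1) (l ^+ k.+1) (k.+3%:R : R) (k.+4%:R : R) => T P n3 n4.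
  by move=> T0 l0' n30 n40; field; rewrite T0 l0' n30 n40.
move=> H.
(* The quarter is absorbed on the left; 2 is a rounding of 4/3. *)
have {}H : l ^+ k.+2 <= 2 * k.+3%:R * CK * s * (l `^ sg / l).
  have : 0 <= l ^+ k.+2 by rewrite exprn_ge0 // ltW.
  move: H; rewrite -!(mulrA 2); move: (l ^+ _) (_ * (_ / l)) => X Y; lra.
have sg0 : 0 < k.+3%:R - sg by rewrite subr_gt0.
have {}H : l `^ (k.+3%:R - sg) <= 2 * k.+3%:R * s * CK.
  rewrite powRB ?(gt_eqF l0) ?implybT // (powR_mulrn _ (ltW l0)).
  rewrite ler_pdivrMr ?powR_gt0 // exprSr -ler_pdivlMr //.
  apply: le_trans H _; rewrite le_eqVlt; apply/orP; left; apply/eqP; field.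
  by rewrite gt_eqF.
have D0 : 0 <= 2 * k.+3%:R * s * CK by apply: le_trans H; exact: powR_ge0.
have lE : l = (l `^ (k.+3%:R - sg)) `^ (k.+3%:R - sg)^-1.
  by rewrite -powRrM mulfV ?gt_eqF // powRr1 // ltW.
rewrite [leLHS]lE; apply: ge0_ler_powR => //; last exact: powR_ge0.
by rewrite invr_ge0 ltW.
Qed.

(** * The estimate in a punctured ball *)

Lemma enorm_scale_delta (R : realType) n (t : R) (i : 'I_n) :
  enorm (t *: delta_mx ord0 i) = `|t|.
Proof.
apply/eqP; rewrite -(@eqrXn2 _ 2) ?enorm_ge0 //; apply/eqP.
rewrite -[t *: _]add0r sqr_enormD_delta enorm0 mxE real_normK ?num_real //; ring.
Qed.

(** The weight [e ^+ m] is lowered to [d ^+ m] and divided out. *)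
Lemma ler_scaled (R : realType) (a b x d e : R) m :
  0 < d -> d <= e -> 0 <= x -> e ^+ m * x <= b ^+ m -> b = a * d ->
  x <= a ^+ m.
Proof.
move=> d0 de x0 H bE; have dm : 0 < d ^+ m by rewrite exprn_gt0.
rewrite -(ler_pM2l dm) mulrC [leRHS]mulrC -exprMn -bE; apply: le_trans H.
rewrite mulrC ler_wpM2r // lerXn2r // nnegrE ltW //; exact: lt_le_trans de.
Qed.

Lemma punctured_estimate (R : realType) k (u : 'rV[R]_k.+3 -> R) (r p q : R) :
  0 < r -> r <= 1 -> 0 <= p -> 0 <= q ->
  k.+1%:R * p + k.+2%:R * q < k.+3%:R ->
  (forall z, 0 < enorm z -> enorm z <= r ->
     [/\ 0 < u z, {for z, continuous u},
         forall i, derivable u z (delta_mx ord0 i) &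
         forall i, {for z, continuous (partial i u)}]) ->
  (forall z, 0 < enorm z -> enorm z < r -> exists2 a : 'I_k.+3 -> R,
     forall i, diff2_at0 (fun t => u (z + t *: delta_mx ord0 i)) (a i) &
     \sum_i a i = - (u z `^ p * enorm (grad u z) `^ q)) ->
  exists2 C, 0 < C & forall x, 0 < enorm x -> enorm x <= r / 16 ->
    u x + enorm x * enorm (grad u x) <= C * (enorm x ^+ k.+1)^-1.
Proof.
move=> r0 r1 p0 q0 hpq regu lapu.
have upos z : 0 < enorm z -> enorm z <= r -> 0 < u z.
  by move=> z1 /(regu z z1)[].
pose z0 : 'rV[R]_k.+3 := (r / 2) *: delta_mx ord0 ord0.
have z0r : enorm z0 = r / 2 by rewrite enorm_scale_delta ger0_norm; lra.
pose c7 := ((5 * r / 8) ^+ k.+1)^-1 - ((7 * r / 8) ^+ k.+1)^-1.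
have c70 : 0 < c7.
  have r5 : 0 < 5 * r / 8 by lra.
  have r7 : 0 < 7 * r / 8 by lra.
  rewrite subr_gt0 ltf_pV2 ?posrE ?exprn_gt0 //.
  by rewrite ltrXn2r // ?nnegrE ?ltW //; lra.
(* The comparison constant depends on [u] through its value at [z0], but not on the centre [y]. *)
pose C0 := u z0 / c7.
have C00 : 0 <= C0.
  by rewrite divr_ge0 ?(ltW c70) // ltW //; apply: upos; rewrite z0r; lra.
have HW y rho mu : enorm y <= r / 8 -> 0 < rho -> rho <= r / 4 -> 0 <= mu ->
    (forall z, enorm (z - y) = rho -> mu <= u z) -> mu * rho ^+ k.+1 <= C0.
  move=> yr rho0 rhor mu0 muu; rewrite ler_pdivlMr //.
  apply: (@superharmonic_ge_fundamental _ _ r _ _ u y z0) => //.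
  - by move=> z z1 /(regu z z1)[].
  - by move=> z z1 /(upos z z1)/ltW.
  - move=> z z1 /(lapu z z1)[a da sa]; exists a => //.
    by rewrite sa oppr_le0 mulr_ge0 ?powR_ge0.
  - by move=> z _; exact: muu.
(* The three summands give, in order, [L <= L ^+ k.+1], the contradiction [hLC] in the first case,
   and the hypothesis [hL] of [height_bound]. *)
pose L : R := 1 + 2 * C0 + 2 ^+ k.+3 * k.+3%:R.
have N0 : 0 <= 2 ^+ k.+3 * k.+3%:R :> R by rewrite mulr_ge0 ?exprn_ge0.
have L1 : 1 <= L by rewrite /L; move: (2 ^+ _ * _) N0 => ? ?; lra.
have L0 : 0 < L by exact: lt_le_trans L1.
have LX : L <= L ^+ k.+1 by exact: ler_eXnr.
have hL : 2 ^+ k.+3 * k.+3%:R <= L ^+ k.+1.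
  by apply: le_trans LX; rewrite /L; move: (2 ^+ _ * _) N0 => ? ?; lra.
have hLC : 2 * C0 < L ^+ k.+1.
  by apply: lt_le_trans LX; rewrite /L; move: (2 ^+ _ * _) N0 => ? ?; lra.
pose s := 4 * k.+3%:R * k.+4%:R * (2 * L) ^+ k.+1.
have s0 : 0 < s by rewrite /s !mulr_gt0 ?exprn_gt0 ?mulr_gt0.
pose l0 := (2 * k.+3%:R * s * (((2 * L) ^+ k.+1) `^ p * (2 ^+ k.+2) `^ q)) `^
        (k.+3%:R - (k.+1%:R * p + k.+2%:R * q))^-1.
have l00 : 0 <= l0 by exact: powR_ge0.
(* If [l > M], the summands 2 and [2 * s] place the balls of radius [d / l] and [s * d / l] inside
   that of radius [d / 2], and [l0] contradicts the gradient case. *)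
pose M := 2 + 2 * s + l0.
have M0 : 0 < M by rewrite /M; lra.
exists ((4 * L * M) ^+ k.+1 + (4 * M) ^+ k.+2).
  by rewrite addr_gt0 ?exprn_gt0 ?mulr_gt0.
move=> x x0 xr; pose delta := enorm x / 2.
have delta0 : 0 < delta by rewrite /delta; lra.
have near_x z : enorm (z - x) <= delta -> 0 < enorm z /\ enorm z <= r / 8.
  move=> zx; have := enormB_le x z 0; rewrite !subr0 enorm_sub.
  have := enormB_le z x 0; rewrite !subr0; move: zx; rewrite /delta.
  by move=> ? ? ?; split; lra.
have regx z : enorm (z - x) <= delta ->
    [/\ 0 < u z, {for z, continuous u},
         forall i, derivable u z (delta_mx ord0 i) &
         forall i, {for z, continuous (partial i u)}].
  by move=> /near_x[z1 z2]; apply: regu => //; lra.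
have xx : enorm (x - x) <= delta by rewrite subrr enorm0 ltW.
(* The weighted maxima of [u] and of its gradient may be attained at different points; a single
   scale [l] serves both. *)
have [yA yAx maxA] := @weighted_max _ _ u x delta k.+1 (ltW delta0)
  (fun z zx => let: And4 _ c _ _ := regx z zx in c).
have [yB yBx maxB] := @weighted_max _ _ (fun z => enorm (grad u z)) x delta k.+2
  (ltW delta0) (fun z zx =>
    let: And4 _ _ _ c := regx z zx in continuous_enorm_grad c).
set A := _ * u yA in maxA; set B := _ * enorm (grad u yB) in maxB.
have A0 : 0 < A.
  apply: lt_le_trans (maxA x xx); rewrite subrr enorm0 subr0 mulr_gt0 ?exprn_gt0 //.
  by have [] := regx x xx.
have B0 : 0 <= B by rewrite mulr_ge0 ?enorm_ge0 // exprn_ge0 // subr_ge0.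
have [l lpos [hA hB hAB]] := common_scale k A0 B0 L0.
(* Within [d / 2] of [y] the distance to the boundary is still at least [d / 2], which costs a
   factor 2 in the scale. *)
have pt y d : d = delta - enorm (y - x) -> 0 < d ->
  forall z, enorm (z - y) <= d / 2 ->
  [/\ enorm (z - x) <= delta, u z <= (2 * L * (l / d)) ^+ k.+1 &
      enorm (grad u z) <= (2 * (l / d)) ^+ k.+2].
  move=> dE d0 z zy.
  have dz : d / 2 <= delta - enorm (z - x) by have := enormB_le z y x; lra.
  have zx : enorm (z - x) <= delta by lra.
  have d20 : 0 < d / 2 by lra.
  split=> //.
    apply: (ler_scaled d20 dz); last 2 first.
    - by apply: le_trans hA; exact: maxA.
    - by field; rewrite gt_eqF.
    - by apply: ltW; have [] := regx z zx.
  apply: (ler_scaled d20 dz); last 2 first.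
  - by apply: le_trans hB; exact: maxB.
  - by field; rewrite gt_eqF.
  - exact: enorm_ge0.
have lM : l <= M.
  rewrite leNgt; apply/negP => Ml.
  have l2 : 2 < l by apply: le_lt_trans Ml; rewrite /M; lra.
  have l2s : 2 * s < l by apply: le_lt_trans Ml; rewrite /M; lra.
  have ll0 : l0 < l by apply: le_lt_trans Ml; rewrite /M; lra.
  (* At distance zero the weight would vanish, its exponent being a successor. *)
  have pos y (f : R) m : enorm (y - x) <= delta ->
      0 < (delta - enorm (y - x)) ^+ m.+1 * f ->
      0 < delta - enorm (y - x).
    move=> yx; have [//|d0] := ltP 0 (delta - enorm (y - x)).
    have -> : delta - enorm (y - x) = 0 by lra.
    by rewrite expr0n mul0r ltxx.
  have small y d : d = delta - enorm (y - x) -> d <= delta.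
    by move=> ->; have := enorm_ge0 (y - x); lra.
  have d1 : delta <= 1 by rewrite /delta; lra.
  have dr : delta <= r / 4 by rewrite /delta; lra.
  case: hAB => [AE|BE].
    pose d := delta - enorm (yA - x).
    have d0 : 0 < d by exact: pos A0.
    have dle : d <= delta by exact: small.
    have P := pt yA d erefl d0.
    have lV : (l / d)^-1 <= d / 2.
      by rewrite invf_div ler_wpM2l ?(ltW d0) // lef_pV2 ?posrE // ltW.
    have ld : 0 < l / d by rewrite divr_gt0.
    suff : L ^+ k.+1 <= 2 * C0 by lra.
    apply: (@height_bound _ _ u yA L (l / d)) => //.
    - exact: ltW.
    - apply: (mulfI (lt0r_neq0 (exprn_gt0 k.+1 d0))).
      by rewrite -[LHS]/A AE -exprMn; congr (_ ^+ _); field; rewrite gt_eqF.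
    - move=> z zy i; have [zx _ gz] := P z (le_trans zy lV); split.
        by have [] := regx z zx.
      apply: le_trans gz; have := normr_coord_enorm (grad u z) i.
      by rewrite mxE.
    - move=> mu mu0 muu; apply: HW muu => //.
      + by have [] := near_x yA yAx.
      + by rewrite invr_gt0.
      + by apply: le_trans lV _; lra.
  have B0' : 0 < B by rewrite BE exprn_gt0.
  pose d := delta - enorm (yB - x).
  have d0 : 0 < d by exact: pos B0'.
  have dle : d <= delta by exact: small.
  have P := pt yB d erefl d0.
  have ld : 0 < l / d by rewrite divr_gt0.
  have sl : s / (l / d) <= d / 2.
    rewrite invf_div mulrCA ler_wpM2l ?(ltW d0) // ler_pdivrMr //; lra.
  have : l / d <= l0.
    apply: (@gradient_scale_bound _ _ u yB p q L (l / d) s) => //.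
    - apply: (mulfI (lt0r_neq0 (exprn_gt0 k.+2 d0))).
      by rewrite -[LHS]/B BE -exprMn; congr (_ ^+ _); field; rewrite gt_eqF.
    - move=> z zy; have [zx uz _] := P z (le_trans zy sl).
      by have [uz0 cz dz _] := regx z zx; split => //; rewrite gtr0_norm.
    - move=> z zy; have [zx uz gz] := P z (le_trans (ltW zy) sl).
      have [z1 z2] := near_x z zx.
      have [|a da sa] := lapu z z1 _; first by lra.
      exists a => //; rewrite sa normrN ger0_norm ?mulr_ge0 ?powR_ge0 //.
      have uz0 := upos z z1 (le_trans z2 _).
      apply: ler_pM; rewrite ?powR_ge0 //; apply: ge0_ler_powR => //.
      + by rewrite nnegrE ltW // uz0 //; lra.
      + by rewrite nnegrE exprn_ge0 // mulr_ge0 ?(ltW ld) // mulr_ge0 // ltW.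
      + by rewrite nnegrE enorm_ge0.
      + by rewrite nnegrE exprn_ge0 // mulr_ge0 // ltW.
  (* Since [d <= delta <= 1], the bound on [l / d] also bounds [l], against [ll0]. *)
  suff : l <= l / d by lra.
  by rewrite ler_pdivlMr // ler_piMr ?ltW //; lra.
have dxx : delta = delta - enorm (x - x) by rewrite subrr enorm0 subr0.
have xx2 : enorm (x - x) <= delta / 2 by rewrite subrr enorm0; lra.
(* At the centre the distance to the boundary is [delta], half of |x|, so the scale
   [2 * (l / delta)] is 4 l / |x|. *)
have [_ ux gx] := pt x delta dxx delta0 x xx2.
have ldE : l / delta = 4 * l / (2 * enorm x).
  by rewrite /delta; field; rewrite gt_eqF.
have e0 := lt0r_neq0 x0.
have M40 : 0 <= 4 * M by rewrite mulr_ge0 // ltW.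
have M4L0 : 0 <= 4 * L * M by rewrite !mulr_ge0 // ltW.
have l40 : 0 <= 4 * l by rewrite mulr_ge0 // ltW.
have lL40 : 0 <= 4 * L * l by rewrite !mulr_ge0 // ltW.
rewrite mulrDl; apply: lerD.
  apply: le_trans ux _; have -> : 2 * L * (l / delta) = 4 * L * l / enorm x.
    by rewrite ldE; field.
  rewrite exprMn exprVn ler_wpM2r ?invr_ge0 ?exprn_ge0 ?enorm_ge0 //.
  by rewrite lerXn2r // ?nnegrE // ler_wpM2l // mulr_ge0 // ltW.
apply: (@le_trans _ _ (enorm x * (4 * l / enorm x) ^+ k.+2)).
  rewrite ler_wpM2l ?enorm_ge0 //; apply: le_trans gx _.
  by rewrite ldE le_eqVlt; apply/orP; left; apply/eqP; congr (_ ^+ _); field.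
have -> : enorm x * (4 * l / enorm x) ^+ k.+2 =
    (4 * l) ^+ k.+2 * (enorm x ^+ k.+1)^-1.
  rewrite exprMn exprVn [enorm x ^+ k.+2]exprS invfM mulrCA.
  by rewrite mulVKf.
rewrite ler_wpM2r ?invr_ge0 ?exprn_ge0 ?enorm_ge0 //.
by rewrite lerXn2r // ?nnegrE // ler_wpM2l.
Qed.

(** * Passage from the domain to a punctured ball *)

Theorem theoremA (R : realType) (N : nat) (hN : (3 <= N)%N)
    (Omega : set 'rV[R]_N) (hOmega : domain Omega) (hOmega0 : Omega 0)
    (p q : R) (hp : 0 <= p) (hq0 : 0 <= q) (hq2 : q <= 2)
    (hpq : (N%:R - 2) * p + (N%:R - 1) * q < N%:R)
    (u : 'rV[R]_N -> R)
    (hu_C2 : Ck_on 2 (Omega `\ 0) u)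
    (hu_pos : forall x, (Omega `\ 0) x -> 0 < u x)
    (hu_eq : forall x, (Omega `\ 0) x ->
       - laplacian u x = u x `^ p * enorm (grad u x) `^ q) :
  exists r c : R, [/\ 0 < r, 0 < c &
    forall x, 0 < enorm x -> enorm x <= r / 2 ->
      Omega x /\
      u x + enorm x * enorm (grad u x) <= c * enorm x `^ (2 - N%:R)].
Proof.
case: N hN Omega hOmega hOmega0 hpq u hu_C2 hu_pos hu_eq => [//|[//|[//|k]]] _.
move=> Omega [openO _] O0 hpq u hu_C2 hu_pos hu_eq.
have E2 : k.+3%:R - 2 = k.+1%:R :> R.
  by rewrite -[k.+3]addn2 natrD addrK.
have E1 : k.+3%:R - 1 = k.+2%:R :> R by rewrite -[k.+3]addn1 natrD addrK.
have /nbhs_norm0P[e /= e0 eO] : \forall z \near (0 : 'rV[R]_k.+3), Omega z.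
  exact: open_nbhs_nbhs.
pose r := Num.min 1 (e / 2).
have r0 : 0 < r by rewrite lt_min ltr01 divr_gt0.
have r1 : r <= 1 by rewrite ge_min lexx.
have re : r < e by rewrite gt_min; apply/orP; right; lra.
(* The neighbourhood is a ball of the sup norm, which the Euclidean norm dominates. *)
have rO z : enorm z <= r -> Omega z.
  move=> zr; apply: eO; apply: le_lt_trans re; apply: le_trans zr.
  exact: normr_le_enorm.
have rU z : 0 < enorm z -> enorm z <= r -> (Omega `\ 0) z.
  by move=> z1 z2; split; [exact: rO|apply/eqP; rewrite -enorm_gt0].
case: hu_C2 => cu du.
have hpq' : k.+1%:R * p + k.+2%:R * q < k.+3%:R by rewrite -E2 -E1.
have regu z : 0 < enorm z -> enorm z <= r ->
    [/\ 0 < u z, {for z, continuous u},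
        forall i, derivable u z (delta_mx ord0 i) &
        forall i, {for z, continuous (partial i u)}].
  move=> z1 z2; have Uz := rU z z1 z2; split; [exact: hu_pos|exact: cu| |].
  - by move=> i; exact: (du i).1.
  - by move=> i; exact: (du i).2.1.
have lapu z : 0 < enorm z -> enorm z < r -> exists2 a : 'I_k.+3 -> R,
     forall i, diff2_at0 (fun t => u (z + t *: delta_mx ord0 i)) (a i) &
     \sum_i a i = - (u z `^ p * enorm (grad u z) `^ q).
  move=> z1 z2; have Uz := rU z z1 (ltW z2).
  exists (fun i => partial i (partial i u) z); last by rewrite -hu_eq // opprK.
  move=> i; apply: diff2_at0_slice; last exact: ((du i).2.2 i).1.
  near=> t; apply: (du i).1; apply: rU.
    by near: t; exact: (near_line _ (@continuous_enorm _ _ _) z1).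
  rewrite -lerN2; apply: ltW; near: t.
  apply: (@near_line _ _ (fun z => - enorm z)); last by rewrite ltrN2.
  by apply: continuousN; exact: continuous_enorm.
have [C C0 HC] := punctured_estimate r0 r1 hp hq0 hpq' regu lapu.
(* [punctured_estimate] reaches [r / 16], which is half of [r / 8]. *)
exists (r / 8), C; split => //; first by rewrite divr_gt0.
move=> x x0 xr.
split; first by apply: rO; lra.
have -> : 2 - k.+3%:R = - k.+1%:R :> R by rewrite -opprB E2.
rewrite powR_invn ?enorm_ge0 //; apply: HC => //; lra.
Unshelve. all: by end_near. Qed.
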